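(* For all sufficiently small $\alpha>0$, with $K:=10^7/\alpha^2$, the following holds for all sufficiently large $n$. Let $\mathcal{H}$ be a $3$-uniform $n$-vertex hypergraph whose edges are properly coloured with $K n^{1/3}\log n$ colours such that each colour appears on at least $\alpha n$ edges. Then $\mathcal{H}$ contains an even cover in which some colour appears exactly once.
   Context: All logarithms are base 2. An edge colouring of a hypergraph is proper if no two edges of the same colour share a vertex (each colour class is a matching). A set $S$ of edges is an even cover if every vertex lies in an even number of edges of $S$. *)

(* Defs.v *)
From HB Require Import structures.
From mathcomp Require Import all_boot all_order all_algebra.
From mathcomp Require Import reals exp.

Set Implicit Arguments.
Unset Strict Implicit.
Unset Printing Implicit Defensive.

Import Order.TTheory GRing.Theory Num.Theory.

Section Hypergraphs.

(* A (simple) hypergraph on the vertex set V is given by its edge set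
   E : {set {set V}}. *)
Context {V : finType}.
Implicit Types (E S : {set {set V}}).

Definition uniform (r : nat) E : Prop := forall e, e \in E -> #|e| = r.

(* A colouring of E with k colours is a function c : {set V} -> 'I_k; only its
   values on E matter. *)
Definition proper_colouring (k : nat) E (c : {set V} -> 'I_k) : Prop :=
  forall e f, e \in E -> f \in E -> e != f -> c e = c f -> [disjoint e & f].

Definition colour_class (k : nat) E (c : {set V} -> 'I_k) (i : 'I_k) :
  {set {set V}} := [set e in E | c e == i].

Definition even_cover S : Prop :=
  forall v : V, ~~ odd #|[set e in S | v \in e]|.

End Hypergraphs.

Definition log2 {R : realType} (x : R) : R := (ln x / ln 2)%R.

(* Main.v *)
Require Import Defs.
From HB Require Import structures.
From mathcomp Require Import all_boot all_order all_algebra.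
From mathcomp Require Import reals exp.
From mathcomp Require Import boolp.
From mathcomp Require Import zify ring lra.

Set Implicit Arguments.
Unset Strict Implicit.
Unset Printing Implicit Defensive.

Import Order.TTheory GRing.Theory Num.Theory.

(** Suppose that in no even cover a colour appears exactly once. For a colour
    [i] let [W i] be the span over F_2 of the edges of the other colours; then
    no edge of colour [i] lies in [W i]. Consider a finite graph whose vertices
    carry vectors such that the two ends of every graph edge differ by a sum of
    hyperedges of distinct colours: a graph edge using colour [i] joins
    different classes modulo [W i], and one not using it stays inside a class.
    Splitting the vertex set along a class and inducting, as for the edge
    isoperimetric inequality of the cube, shows that such a graph on [N]
    vertices has O(Delta N log N) edges if every vertex meets at most [Delta]
    edges using any given colour.

    This is applied twice. If many hyperedges contain a heavy pair, i.e. a pair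
    of vertices in more than [D] ~ log n / alpha hyperedges, use the bipartite
    graph joining the heavy pair of a hyperedge to its third vertex. Otherwise
    use a Kikuchi graph on V^l with l ~ n^(1/3): two hyperedges {u, a, a'} and
    {u, b, b'} allow one to replace an entry a of a tuple by a' and another
    entry b by b'. As no pair is heavy, a second moment computation shows that
    few Kikuchi edges are at a tuple which meets many edges using the same
    colour, and the remaining ones are too numerous. *)

(** * Edges separated by equivalence relations *)

(** In logarithms this is [D] times a + a log a + b log b <= (a + b) log (a + b), which holds
    because 2a and b are both at most a + b. *)
Lemma expn_split_bound (a b D : nat) : a <= b ->
  2 ^ (D * a) * (a ^ (D * a) * b ^ (D * b)) <= (a + b) ^ (D * (a + b)).
Proof.
move=> leab.
rewrite mulnA -expnMn mulnDr expnD leq_mul //.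
- by case: (posnP (D * a)) => [->//|D0]; rewrite leq_exp2r //; lia.
- by case: (posnP (D * b)) => [->//|D0]; rewrite leq_exp2r //; lia.
Qed.

Section SeparatedEdges.
Variables (T B : finType) (I : Type) (eqv : I -> rel T) (src tgt : B -> T).
Variables (edges : {set B}) (Delta : nat).

Definition separated i b := ~~ eqv i (src b) (tgt b).

Hypothesis eqv_equiv : forall i, equivalence_rel (eqv i).
Hypothesis edge_separated : forall b, b \in edges -> exists i, separated i b.
Hypothesis out_degree : forall i x,
  #|[set b in edges | (src b == x) && separated i b]| <= Delta.
Hypothesis in_degree : forall i x,
  #|[set b in edges | (tgt b == x) && separated i b]| <= Delta.

Let inner (A : {set T}) := [set b in edges | (src b \in A) && (tgt b \in A)].

Let touching i (A : {set T}) :=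
  [set b in edges | ((src b \in A) || (tgt b \in A)) && separated i b].

Let card_touching i A : #|touching i A| <= 2 * Delta * #|A|.
Proof.
apply: (@leq_trans (\sum_(x in A) (Delta + Delta))); last first.
  by rewrite sum_nat_const; lia.
apply: (@leq_trans (\sum_(x in A)
    (#|[set b in edges | (src b == x) && separated i b]| +
     #|[set b in edges | (tgt b == x) && separated i b]|))); last first.
  by apply: leq_sum => x _; exact: leq_add (out_degree i x) (in_degree i x).
have -> : touching i A =
  \bigcup_(x in A) ([set b in edges | (src b == x) && separated i b] :|:
                    [set b in edges | (tgt b == x) && separated i b]).
  apply/setP=> b; rewrite !inE; apply/idP/bigcupP.
    case/and3P=> bE /orP[bA|bA] sb.
      by exists (src b) => //; rewrite !inE bE eqxx sb.
    by exists (tgt b) => //; rewrite !inE bE eqxx sb orbT.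
  case=> x xA; rewrite !inE.
  by case/orP=> /and3P[-> /eqP-> ->]; rewrite xA ?orbT.
elim/big_rec2: _ => [|x m S _ IH]; first by rewrite cards0.
rewrite (leq_trans (leq_card_setU _ _).1) // leq_add //.
by rewrite (leq_trans (leq_card_setU _ _).1).
Qed.

(** Exponentiated form of the bound 2 Delta |A| log |A|. An edge between a class of [eqv i] and its
    complement is separated by [i], so at most 2 Delta times the size of the smaller half cross;
    [expn_split_bound] absorbs this. *)
Lemma separated_edges_inner (A : {set T}) :
  2 ^ #|inner A| <= #|A| ^ (2 * Delta * #|A|).
Proof.
have [m] := ubnP #|A|; elim: m A => // m IH A ltAm.
have [->|] := eqVneq (inner A) set0.
  (* An empty [A] is covered by 0 ^ 0 = 1. *)
  by rewrite cards0 expn_gt0; case: posnP => // ->; rewrite muln0.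
case/set0Pn=> b; rewrite !inE => /and3P[bE sA tA].
have [i sb] := edge_separated bE.
have er x : eqv i x x by have [] := eqv_equiv i x x x.
have es x y z : eqv i x y -> eqv i x z = eqv i y z by have [] := eqv_equiv i x y z.
pose A1 := A :&: [set x | eqv i (src b) x]; pose A2 := A :\: A1.
have A1A : A1 \subset A by apply: subsetIl.
have c12 : #|A1| + #|A2| = #|A|.
  by rewrite -(cardsID A1 A) (setIidPr A1A).
have s1 : src b \in A1 by rewrite !inE sA er.
have t2 : tgt b \in A2 by rewrite !inE tA andbT /= (negbTE sb).
have p1 : 0 < #|A1| by apply/card_gt0P; exists (src b).
have p2 : 0 < #|A2| by apply/card_gt0P; exists (tgt b).
(* Stated for either half, so that crossing edges can be charged to the smaller one. *)
have cross A' : A' = A1 \/ A' = A2 ->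
    inner A \subset inner A1 :|: inner A2 :|: touching i A'.
  move=> hA'; apply/subsetP=> b'; rewrite !inE /separated => /and3P[-> s' t'].
  have H x : x \in A -> (x \in A1) = eqv i (src b) x by rewrite !inE => ->.
  have Hx x : x \in A -> (x \in A') =
      (if A' == A1 then eqv i (src b) x else ~~ eqv i (src b) x).
    move=> xA; case: eqP => [->|ne]; first exact: H.
    by case: hA' => // ->; rewrite !inE xA /= andbT.
  rewrite (Hx _ s') (Hx _ t') s' t' /=.
  have S1 : eqv i (src b) (src b') -> ~~ eqv i (src b) (tgt b') ->
      ~~ eqv i (src b') (tgt b').
    by move=> h; rewrite (es _ _ _ h).
  have S2 : eqv i (src b) (tgt b') -> ~~ eqv i (src b) (src b') ->
      ~~ eqv i (src b') (tgt b').
    move=> h h'; apply: contra h' => h'.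
    by rewrite (es _ _ _ h) // -(es _ _ _ h') // er.
  move: S1 S2; case: (eqv i (src b) (src b')); case: (eqv i (src b) (tgt b'));
    case: ifP => //= _ S1 S2;
    by [exact: S1 | exact: S2].
have crossc A' : A' = A1 \/ A' = A2 ->
    #|inner A| <= 2 * Delta * #|A'| + (#|inner A1| + #|inner A2|).
  move=> hA'; apply: (leq_trans (subset_leq_card (cross _ hA'))).
  rewrite (leq_trans (leq_card_setU _ _).1) // addnC leq_add //.
  by rewrite (leq_card_setU _ _).1.
have IH1 := IH A1 ltac:(lia); have IH2 := IH A2 ltac:(lia).
rewrite -c12; case: (leqP #|A1| #|A2|) => [le|/ltnW le].
- apply: leq_trans (expn_split_bound _ le).
  apply: (@leq_trans (2 ^ (2 * Delta * #|A1| + (#|inner A1| + #|inner A2|)))).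
    by rewrite leq_exp2l // crossc //; left.
  by rewrite !expnD leq_mul // leq_mul.
- rewrite addnC; apply: leq_trans (expn_split_bound _ le).
  apply: (@leq_trans (2 ^ (2 * Delta * #|A2| + (#|inner A2| + #|inner A1|)))).
    by rewrite leq_exp2l // [(#|inner A2| + _)%N]addnC crossc //; right.
  by rewrite !expnD leq_mul // leq_mul.
Qed.

Lemma separated_edges_bound (A : {set T}) (M : nat) :
  (forall b, b \in edges -> (src b \in A) && (tgt b \in A)) ->
  #|A| <= 2 ^ M -> #|edges| <= 2 * Delta * #|A| * M.
Proof.
move=> eA leM; have -> : edges = inner A.
  by apply/setP=> b; rewrite !inE; case: (boolP (b \in edges)) => // /eA ->.
rewrite -(@leq_exp2l 2) //; apply: leq_trans (separated_edges_inner A) _.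
rewrite [X in _ <= 2 ^ X]mulnC [X in _ <= X]expnM.
by case: (posnP (2 * Delta * #|A|)) => [->//|p]; rewrite leq_exp2r.
Qed.
End SeparatedEdges.

(** * Resampling one coordinate of a tuple *)

Section Resample.
Variables (V J : finType).

Definition update (x : {ffun J -> V}) r v := [ffun s => if s == r then v else x s].

(** Exchanging [v] with the overwritten value [x r] is an involution on pairs, and it carries
    [update x r v] to [x]. *)
Lemma resample r (F : {ffun J -> V} -> nat) :
  \sum_x \sum_v F (update x r v) = #|V| * \sum_x F x.
Proof.
rewrite pair_bigA /=.
pose h (z : {ffun J -> V} * V) := (update z.1 r z.2, z.1 r).
have hK : involutive h.
  move=> [x v]; rewrite /h /=; congr pair; last by rewrite ffunE eqxx.
  by apply/ffunP=> s; rewrite !ffunE; case: eqP => [->|].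
rewrite (reindex_inj (inv_inj hK)) /=.
rewrite (eq_bigr (fun z : {ffun J -> V} * V => F z.1)) => [|[x v] _]; last first.
  by have := hK (x, v); rewrite /h /= => -[-> _].
rewrite -(pair_bigA _ (fun x v => F x)) /= big_distrr /=.
by apply: eq_bigr => x _; rewrite sum_nat_const.
Qed.

Lemma update_eq x r v : update x r v r = v.
Proof. by rewrite ffunE eqxx. Qed.

Lemma update_neq x r v s : s != r -> update x r v s = x s.
Proof. by rewrite ffunE => /negbTE->. Qed.
End Resample.

(** * Coloured triple systems *)

Lemma card_set_sum (T : finType) (P : pred T) : #|[set x | P x]| = \sum_x P x.
Proof. by rewrite -sum1dep_card big_mkcond; apply: eq_bigr => x _; case: (P x). Qed.

Lemma sum_pair (A B : finType) (F : A * B -> nat) :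
  \sum_z F z = \sum_a \sum_b F (a, b).
Proof. by rewrite pair_bigA; apply: eq_bigr => -[]. Qed.

(** Cauchy-Schwarz, from summing 2 f(x) f(y) <= f(x)^2 + f(y)^2 over all pairs. *)
Lemma sum_square (T : finType) (f : T -> nat) :
  (\sum_x f x) ^ 2 <= #|T| * \sum_x f x ^ 2.
Proof.
have E : \sum_x \sum_y (f x ^ 2 + f y ^ 2) = 2 * (#|T| * \sum_x f x ^ 2).
  under eq_bigr do rewrite big_split /= sum_nat_const.
  by rewrite big_split /= sum_nat_const -big_distrr /= -mulnDr addnn -mul2n mulnCA.
rewrite -(@leq_pmul2l 2) // -E -mulnn big_distrl big_distrr /=; apply: leq_sum => x _.
by rewrite big_distrr big_distrr; apply: leq_sum => y _; exact: nat_Cauchy.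
Qed.

Section TripleSystem.
Variables (V C : finType) (U : zmodType) (delta : V -> U) (W : C -> pred U).

(* [t u a b] says that {u, a, b} is a hyperedge, so each hyperedge is counted
   with all its orderings; [W i] is the span of the edges of colour not [i]. *)
Record triple_system (t : V -> V -> V -> bool) (col : V -> V -> V -> C) : Prop :=
  TripleSystem {
    triple_swap12 : forall u a b, t u a b = t a u b;
    triple_swap23 : forall u a b, t u a b = t u b a;
    colour_swap12 : forall u a b, col u a b = col a u b;
    colour_swap23 : forall u a b, col u a b = col u b a;
    triple_colour_degree : forall u i,
      \sum_a \sum_b (t u a b && (col u a b == i)) <= 2;
    triple_char2 : forall x : U, (x + x = 0)%R;
    triple_span0 : forall i, W i 0%R;
    triple_spanB : forall i x y, W i x -> W i y -> W i (x - y)%R;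
    triple_other_colour : forall i u a b,
      t u a b -> col u a b != i -> W i (delta u + delta a + delta b)%R;
    triple_own_colour : forall u a b,
      t u a b -> ~~ W (col u a b) (delta u + delta a + delta b)%R }.

Variables (t : V -> V -> V -> bool) (col : V -> V -> V -> C).
Hypothesis sys : triple_system t col.
Let tC12 := triple_swap12 sys.
Let tC23 := triple_swap23 sys.
Let colC12 := colour_swap12 sys.
Let colC23 := colour_swap23 sys.
Let colour_degree := triple_colour_degree sys.
Let addUU := triple_char2 sys.
Let W0 := triple_span0 sys.
Let WB := triple_spanB sys.
Let other_colour := triple_other_colour sys.
Let own_colour := triple_own_colour sys.

Lemma opprU (x : U) : (- x)%R = x.
Proof. by apply/esym/eqP; rewrite -addr_eq0 addUU. Qed.

Lemma WD i x y : W i x -> W i y -> W i (x + y)%R.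
Proof. by rewrite -{2}[y]opprU; apply: WB. Qed.

Lemma congruence_equiv (T : Type) (f : T -> U) i :
  equivalence_rel (fun x y => W i (f x - f y)%R).
Proof.
move=> x y z; split=> [|xy]; first by rewrite subrr.
apply/idP/idP => [xz|yz].
  by have := WB xz xy; rewrite opprB addrC addrA subrK.
by have := WD xy yz; rewrite addrA subrK.
Qed.

Lemma sum_colours (P : bool) (j : C) : \sum_i (P && (j == i)) = P.
Proof.
rewrite (bigD1 j) //= eqxx andbT big1 ?addn0 // => i /negbTE.
by rewrite eq_sym => ->; rewrite andbF.
Qed.

Lemma vertex_degree u : \sum_a \sum_b t u a b <= 2 * #|C|.
Proof.
rewrite (eq_bigr (fun a => \sum_i \sum_b (t u a b && (col u a b == i)))) => [|a _].
  rewrite exchange_big mulnC -sum_nat_const; exact: leq_sum.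
by rewrite exchange_big; apply: eq_bigr => b _; rewrite sum_colours.
Qed.

Definition triples := \sum_u \sum_a \sum_b t u a b.

Definition codeg a b := \sum_u t a b u.
Definition heavy_pairs D := [set ab : V * V | D < codeg ab.1 ab.2].

Lemma codeg_rotate u a b : t a b u = t u a b.
Proof. by rewrite tC23 tC12. Qed.

Lemma col_rotate u a b : col a b u = col u a b.
Proof. by rewrite colC23 colC12. Qed.

(** Markov's inequality, since the codegrees sum to [triples]. *)
Lemma card_heavy_pairs D : D * #|heavy_pairs D| <= triples.
Proof.
have -> : triples = \sum_a \sum_b codeg a b.
  rewrite /triples exchange_big; apply: eq_bigr => a _.
  rewrite exchange_big; apply: eq_bigr => b _.
  by apply: eq_bigr => u _; rewrite codeg_rotate.
rewrite card_set_sum big_distrr sum_pair /=; apply: leq_sum => a _; apply: leq_sum => b _.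
by case: ltnP => [/ltnW|]; rewrite ?muln1 ?muln0.
Qed.

(** A triple with heavy pair (a, b) is a graph edge from [inl u] to [inr (a, b)], whose ends differ
    by the vector of one hyperedge. Only the colour of that hyperedge can separate it, so the degree
    bound per colour is 2. *)
Lemma heavy_triples_bound D M : #|V| + #|V| ^ 2 <= 2 ^ M ->
  \sum_u \sum_a \sum_b (t u a b && (D < codeg a b)) <=
  4 * (#|V| + #|heavy_pairs D|) * M.
Proof.
move=> leM.
pose T := (V + V * V)%type; pose B := (V * (V * V))%type.
pose src (z : B) : T := inl z.1; pose tgt (z : B) : T := inr z.2.
pose edges : {set B} := [set z | t z.1 z.2.1 z.2.2 && (z.2 \in heavy_pairs D)].
pose f (y : T) : U :=
  match y with inl u => delta u | inr ab => (delta ab.1 + delta ab.2)%R end.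
have fE z : (f (src z) - f (tgt z) = delta z.1 + delta z.2.1 + delta z.2.2)%R.
  by rewrite opprU addrA.
pose A : {set T} := [set inl u | u in V] :|: [set inr ab | ab in heavy_pairs D].
have cA : #|A| = #|V| + #|heavy_pairs D|.
  rewrite cardsU disjoint_setI0 ?cards0 ?subn0; last first.
    rewrite disjoints_subset; apply/subsetP=> y /imsetP[u _ ->].
    by rewrite inE; apply/imsetP=> -[].
  by rewrite !card_imset // => ? ? [].
have -> : \sum_u \sum_a \sum_b (t u a b && (D < codeg a b)) = #|edges|.
  rewrite card_set_sum sum_pair; apply: eq_bigr => u _; rewrite sum_pair.
  by do 2!(apply: eq_bigr => ? _); rewrite inE.
rewrite -cA.
apply: (@separated_edges_bound _ _ _ (fun i x y => W i (f x - f y)%R) src tgt edges 2).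
- exact: congruence_equiv.
- move=> z; rewrite inE => /andP[tz _]; exists (col z.1 z.2.1 z.2.2).
  by rewrite /separated fE own_colour.
- move=> i [u|ab]; last first.
    rewrite (_ : [set _ in _ | _] = set0) ?cards0 //.
    by apply/setP=> z; rewrite !inE /= andbF.
  apply: leq_trans (colour_degree u i).
  rewrite card_set_sum sum_pair (bigD1 u) //= [X in _ + X]big1 ?addn0; last first.
    move=> v ne; rewrite big1 // => ab _.
    rewrite /src /= (_ : inl v == inl u = false) ?andbF //.
    by apply/eqP=> -[E]; rewrite E eqxx in ne.
  rewrite sum_pair; apply: leq_sum => a _; apply: leq_sum => b _.
  rewrite inE /separated fE /=; case: (boolP (t u a b)) => //= tu.
  case: (boolP (col u a b == i)) => [_|ne]; first by case: (_ && _).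
  by rewrite (other_colour tu ne) !andbF.
- move=> i [u|[a b]].
    rewrite (_ : [set _ in _ | _] = set0) ?cards0 //.
    by apply/setP=> z; rewrite !inE /= andbF.
  apply: leq_trans (colour_degree a i).
  rewrite card_set_sum sum_pair exchange_big (bigD1 (a, b)) //=.
  rewrite [X in _ + X]big1 ?addn0; last first.
    move=> ab ne; rewrite big1 // => v _.
    rewrite /tgt /= (_ : inr ab == inr (a, b) = false) ?andbF //.
    by apply/eqP=> -[E]; rewrite E eqxx in ne.
  rewrite [X in _ <= X](bigD1 b) //=; apply: leq_trans (leq_addr _ _).
  apply: leq_sum => u _; rewrite codeg_rotate col_rotate.
  rewrite inE /separated fE /=; case: (boolP (t u a b)) => //= tu.
  case: (boolP (col u a b == i)) => [_|ne]; first by case: (_ && _).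
  by rewrite (other_colour tu ne) !andbF.
- move=> z; rewrite !inE => /andP[_ hz]; apply/andP; split; apply/orP; [left|right].
    by apply/imsetP; exists z.1.
  by apply/imsetP; exists z.2 => //; rewrite inE.
- apply: leq_trans leM; rewrite cA leq_add2l -mulnn -card_prod.
  exact: max_card.
Qed.

(** * Kikuchi pairs, their weights and second moments *)

Section Kikuchi.
Variable D : nat.
Hypothesis codegree : forall u b, \sum_b' t u b b' <= D.

(** Distinct colours keep the sum of the two hyperedges out of [W] of either colour. *)
Definition kikuchi_pair u a a' b b' :=
  [&& t u a a', t u b b' & col u a a' != col u b b'].

Definition weight i a b :=
  \sum_u \sum_a' \sum_b' (kikuchi_pair u a a' b b' && (col u a a' == i)).

Let kp_le i u a a' b b' :
  (kikuchi_pair u a a' b b' && (col u a a' == i) : nat) <=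
  (t u a a' && (col u a a' == i)) * t u b b'.
Proof. rewrite /kikuchi_pair.
by case: (t u a a') (t u b b') (_ == i) (_ != _) => [] [] [] []. Qed.

Let through_colour i a : \sum_u \sum_a' (t u a a' && (col u a a' == i)) <= 2.
Proof.
rewrite (eq_bigr (fun u => \sum_a' (t a u a' && (col a u a' == i)))) //.
by move=> u _; apply: eq_bigr => a' _; rewrite tC12 colC12.
Qed.

(** Colour [i] leaves at most two choices of (u, a') at [a], and each leaves at most [D] choices of
    b'. *)
Lemma weight_le i a b : weight i a b <= 2 * D.
Proof.
apply: (@leq_trans (\sum_u \sum_a' (t u a a' && (col u a a' == i)) * D)).
  apply: leq_sum => u _; apply: leq_sum => a' _.
  apply: leq_trans (leq_mul (leqnn _) (codegree u b)).
  by rewrite big_distrr /=; apply: leq_sum.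
by under eq_bigr do rewrite -big_distrl /=; rewrite -big_distrl /= leq_mul.
Qed.

Lemma sum_weight_right i a : \sum_b weight i a b <= 4 * #|C|.
Proof.
apply: (@leq_trans (\sum_u \sum_a' (t u a a' && (col u a a' == i)) * (2 * #|C|))).
  rewrite exchange_big; apply: leq_sum => u _.
  rewrite exchange_big; apply: leq_sum => a' _.
  apply: leq_trans (leq_mul (leqnn _) (vertex_degree u)).
  rewrite big_distrr /=; apply: leq_sum => b _.
  by rewrite big_distrr /=; apply: leq_sum.
under eq_bigr do rewrite -big_distrl /=; rewrite -big_distrl /=.
by rewrite (leq_trans (leq_mul (through_colour i a) (leqnn _))) // mulnA.
Qed.

(** Here the second hyperedge is chosen first: at most 2 |C| pairs (u, b') at [b], then at most two
    pairs (a, a') of colour [i] at [u]. *)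
Lemma sum_weight_left i b : \sum_a weight i a b <= 4 * #|C|.
Proof.
apply: (@leq_trans (\sum_u (2 * \sum_b' t u b b'))).
  rewrite exchange_big; apply: leq_sum => u _.
  apply: leq_trans (leq_mul (colour_degree u i) (leqnn _)).
  rewrite big_distrl /=; apply: leq_sum => a _.
  rewrite big_distrl /=; apply: leq_sum => a' _.
  by rewrite big_distrr /=; apply: leq_sum.
rewrite -big_distrr /= -[4]/(2 * 2) -mulnA leq_mul2l /=.
apply: leq_trans (vertex_degree b); apply/eq_leq; apply: eq_bigr => u _.
by apply: eq_bigr => b' _; rewrite tC12.
Qed.

Variable l : nat.
Local Notation tuple_ := {ffun 'I_l -> V}.
Let n := #|V|.

Definition out_weight i (x : tuple_) :=
  \sum_p \sum_(q | q != p) weight i (x p) (x q).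

(* Resampling a coordinate of [x] outside [{p, q}] leaves the first factor
   unchanged and averages the second one over a row or column of [weight]. *)
Lemma weight_correlation i (p q p2 q2 : 'I_l) : p2 != q2 ->
  n * (\sum_(x : tuple_) weight i (x p) (x q) * weight i (x p2) (x q2)) <=
  (4 * #|C| + ((p2 \in [:: p; q]) && (q2 \in [:: p; q])) * (2 * D * n)) *
  \sum_(x : tuple_) weight i (x p) (x q).
Proof.
move=> ne2; case: (boolP (q2 \in [:: p; q])) => [q2in|q2out]; last first.
  rewrite andbF mul0n addn0 -(resample q2) big_distrr /=; apply: leq_sum => x _.
  rewrite !inE negb_or eq_sym [q2 == q]eq_sym in q2out; case/andP: q2out => ne_p ne_q.
  under eq_bigr do
    rewrite (update_neq _ _ ne_p) (update_neq _ _ ne_q) (update_neq _ _ ne2) update_eq.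
  by rewrite -big_distrr /= [X in X <= _]mulnC leq_mul ?sum_weight_right.
case: (boolP (p2 \in [:: p; q])) => [p2in|p2out]; last first.
  rewrite mul0n addn0 -(resample p2) big_distrr /=; apply: leq_sum => x _.
  rewrite !inE negb_or eq_sym [p2 == q]eq_sym in p2out; case/andP: p2out => ne_p ne_q.
  have ne2' : q2 != p2 by rewrite eq_sym.
  under eq_bigr do
    rewrite (update_neq _ _ ne_p) (update_neq _ _ ne_q) (update_neq _ _ ne2') update_eq.
  by rewrite -big_distrr /= [X in X <= _]mulnC leq_mul ?sum_weight_left.
rewrite mul1n; apply: (@leq_trans ((2 * D * n) * \sum_(x : tuple_) weight i (x p) (x q))).
  rewrite mulnAC mulnC leq_mul // mulnC big_distrl /=; apply: leq_sum => x _.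
  by rewrite leq_mul ?weight_le.
by rewrite leq_mul ?leq_addl.
Qed.

(** For fixed (p, q), each of at most l^2 pairs (p2, q2) contributes 4 |C|, and the at most four
    with both entries in {p, q} contribute 2 D n more. *)
Lemma second_moment i :
  n * (\sum_x out_weight i x * out_weight i x) <=
  (4 * #|C| * l ^ 2 + 8 * D * n) * \sum_x out_weight i x.
Proof.
have -> : \sum_x out_weight i x =
    \sum_p \sum_(q | q != p) \sum_(x : tuple_) weight i (x p) (x q).
  by rewrite exchange_big; apply: eq_bigr => p _; rewrite exchange_big.
have -> : \sum_x out_weight i x * out_weight i x =
    \sum_p \sum_(q | q != p) \sum_p2 \sum_(q2 | q2 != p2)
      \sum_(x : tuple_) weight i (x p) (x q) * weight i (x p2) (x q2).
  transitivity (\sum_(x : tuple_) \sum_p \sum_(q | q != p) \sum_p2 \sum_(q2 | q2 != p2)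
      weight i (x p) (x q) * weight i (x p2) (x q2)).
    apply: eq_bigr => x _; rewrite big_distrl /=; apply: eq_bigr => p _.
    rewrite big_distrl /=; apply: eq_bigr => q _.
    by rewrite big_distrr /=; apply: eq_bigr => p2 _; rewrite big_distrr /=.
  rewrite exchange_big; apply: eq_bigr => p _.
  rewrite exchange_big; apply: eq_bigr => q _.
  by rewrite exchange_big; apply: eq_bigr => p2 _; rewrite exchange_big.
rewrite !big_distrr /=; apply: leq_sum => p _.
rewrite !big_distrr /=; apply: leq_sum => q _.
rewrite big_distrr /=; under eq_bigr do rewrite big_distrr /=.
apply: (@leq_trans (\sum_(p2 < l) \sum_(q2 < l)
   (4 * #|C| + ((p2 \in [:: p; q]) && (q2 \in [:: p; q])) * (2 * D * n)) *
  \sum_(x : tuple_) weight i (x p) (x q))).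
  apply: leq_sum => p2 _; rewrite [X in _ <= X](bigID (fun q2 => q2 != p2)) /=.
  apply: leq_trans (leq_addr _ _); apply: leq_sum => q2.
  by rewrite eq_sym; apply: weight_correlation.
set S := \sum_(x : tuple_) _.
rewrite (eq_bigr (fun p2 => (\sum_(q2 < l) (4 * #|C| +
   ((p2 \in [:: p; q]) && (q2 \in [:: p; q])) * (2 * D * n))) * S)); last first.
  by move=> p2 _; rewrite big_distrl.
rewrite -big_distrl /= leq_mul // {S}.
have cpq : \sum_(q2 < l) (q2 \in [:: p; q]) <= 2.
  rewrite -card_set_sum; apply: leq_trans (card_size [:: p; q]).
  by apply/subset_leq_card/subsetP => z; rewrite !inE.
under eq_bigr => p2 _.
  rewrite big_split /= sum_nat_const card_ord -big_distrl /=.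
  under [X in _ + X * _]eq_bigr do rewrite -mulnb.
  rewrite -big_distrr /=; over.
rewrite /= big_split /= sum_nat_const card_ord -big_distrl /= -big_distrl /=.
rewrite leq_add //; first by lia.
have := leq_mul cpq cpq; set S := _ * _; move=> hS.
by apply: (leq_trans (leq_mul hS (leqnn _))); lia.
Qed.

(** * Labels of Kikuchi edges: symmetries and counting *)

(* The label (x, (p, q), (u, a', b')) stands for the oriented Kikuchi edge at
   [x] given by the hyperedges {u, x p, a'} and {u, x q, b'}. *)
Definition label := (tuple_ * ('I_l * 'I_l) * (V * V * V))%type.
Definition source (z : label) := z.1.1.
Definition pos1 (z : label) := z.1.2.1.
Definition pos2 (z : label) := z.1.2.2.
Definition apex (z : label) := z.2.1.1.
Definition new1 (z : label) := z.2.1.2.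
Definition new2 (z : label) := z.2.2.
Definition old1 z := source z (pos1 z).
Definition old2 z := source z (pos2 z).
Definition colour1 z := col (apex z) (old1 z) (new1 z).
Definition colour2 z := col (apex z) (old2 z) (new2 z).
Definition target z := update (update (source z) (pos1 z) (new1 z)) (pos2 z) (new2 z).
Definition valid z :=
  (pos2 z != pos1 z) && kikuchi_pair (apex z) (old1 z) (new1 z) (old2 z) (new2 z).

(** Together with [reverse], this symmetry relates the two colours and the two ends of a Kikuchi
    edge, so that only first colours at sources have to be counted. *)
Definition swap z : label :=
  (source z, (pos2 z, pos1 z), (apex z, new2 z, new1 z)).
Definition reverse z : label :=
  (target z, (pos1 z, pos2 z), (apex z, old1 z, old2 z)).

Lemma swapK : involutive swap.
Proof. by move=> [[x [p q]] [[u a] b]]. Qed.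

Lemma kikuchi_pairC u a a' b b' : kikuchi_pair u a a' b b' = kikuchi_pair u b b' a a'.
Proof. by rewrite /kikuchi_pair eq_sym; case: (t u a a'); case: (t u b b'). Qed.

Lemma valid_swap z : valid (swap z) = valid z.
Proof. by rewrite /valid kikuchi_pairC eq_sym. Qed.

Lemma target_pos1 z : pos2 z != pos1 z -> target z (pos1 z) = new1 z.
Proof. by move=> ne; rewrite /target update_neq 1?eq_sym // update_eq. Qed.

Lemma target_pos2 z : target z (pos2 z) = new2 z.
Proof. by rewrite /target update_eq. Qed.

(** Distinct positions prevent the second update from overwriting the first. *)
Lemma reverseK z : pos2 z != pos1 z -> reverse (reverse z) = z.
Proof.
move=> ne; have E1 := target_pos1 ne; have E2 := target_pos2 z.
rewrite {1}/reverse /old1 /old2 /= E1 E2.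
have -> : target (reverse z) = source z.
  apply/ffunP=> s; rewrite /target !ffunE /= /old2 /old1.
  rewrite -/(pos2 z) -/(pos1 z).
  by case: (eqVneq s (pos2 z)) => [->//|_]; case: (eqVneq s (pos1 z)) => [->|].
by case: z {ne E1 E2} => [[x [p q]] [[u a] b]].
Qed.

Lemma valid_reverse z : valid z -> valid (reverse z).
Proof.
rewrite /valid => /andP[ne kp]; rewrite ne /= /kikuchi_pair /old1 /old2 /=.
rewrite target_pos1 // target_pos2.
by rewrite ![t (apex z) (new1 z) _]tC23 ![t (apex z) (new2 z) _]tC23
  [col (apex z) (new1 z) _]colC23 [col (apex z) (new2 z) _]colC23.
Qed.

Lemma colour1_reverse z : pos2 z != pos1 z -> colour1 (reverse z) = colour1 z.
Proof. by move=> ne; rewrite /colour1 /old1 /= target_pos1 // colC23. Qed.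

Lemma colour2_reverse z : colour2 (reverse z) = colour2 z.
Proof. by rewrite /colour2 /old2 /= target_pos2 // colC23. Qed.

Lemma sum_label (F : label -> nat) :
  \sum_z F z = \sum_x \sum_p \sum_q \sum_u \sum_a \sum_b F (x, (p, q), (u, a, b)).
Proof.
rewrite !sum_pair; apply: eq_bigr => x _; rewrite sum_pair.
by do 2!(apply: eq_bigr => ? _); rewrite !sum_pair.
Qed.

Lemma card_out_labels i x :
  #|[set z | [&& valid z, source z == x & colour1 z == i]]| = out_weight i x.
Proof.
rewrite card_set_sum sum_label (bigD1 x) //= [X in _ + X]big1 ?addn0.
  rewrite /out_weight; apply: eq_bigr => p _.
  rewrite [RHS]big_mkcond; apply: eq_bigr => q _.
  rewrite /valid /colour1 /old1 /old2 /source /pos1 /pos2 /= eqxx /=.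
  case: (q != p) => /=; last by do 3!(rewrite big1 // => ? _).
  by [].
move=> y ne; do 5!(rewrite big1 // => ? _).
by rewrite /source /= (negbTE ne) !andbF.
Qed.

Lemma card_valid : #|[set z | valid z]| = \sum_i \sum_x out_weight i x.
Proof.
rewrite card_set_sum.
rewrite (eq_bigr (fun z => \sum_i (valid z && (colour1 z == i)))) => [|z _]; last first.
  by rewrite sum_colours.
rewrite exchange_big; apply: eq_bigr => i _.
under [RHS]eq_bigr do rewrite -card_out_labels card_set_sum.
rewrite exchange_big; apply: eq_bigr => z _.
rewrite (bigD1 (source z)) //= eqxx big1 ?addn0 // => x /negbTE.
by rewrite eq_sym => ->; rewrite andbF.
Qed.

Lemma sum_two_positions (F : V -> V -> nat) (p q : 'I_l) : q != p ->
  n * (n * \sum_(x : tuple_) F (x p) (x q)) = n ^ l * \sum_a \sum_b F a b.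
Proof.
move=> ne; rewrite -(resample q) -(resample p).
under eq_bigr => x _ do under eq_bigr => a _ do under eq_bigr => b _ do
  rewrite update_eq update_neq 1?eq_sym // update_eq.
by rewrite sum_nat_const card_ffun card_ord.
Qed.

Definition total_weight := \sum_i \sum_a \sum_b weight i a b.

(** Each of the l (l - 1) position pairs admits n^(l - 2) tuples with given entries there; the
    factor n^2 avoids a division. *)
Lemma card_valid_weight :
  n ^ 2 * #|[set z | valid z]| = l * l.-1 * n ^ l * total_weight.
Proof.
rewrite card_valid /total_weight !big_distrr /=; apply: eq_bigr => i _.
have -> : \sum_x out_weight i x =
    \sum_p \sum_(q | q != p) \sum_(x : tuple_) weight i (x p) (x q).
  by rewrite exchange_big; apply: eq_bigr => p _; rewrite exchange_big.
rewrite big_distrr /=.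
rewrite (eq_bigr (fun _ => l.-1 * (n ^ l * \sum_a \sum_b weight i a b))) => [|p _].
  by rewrite sum_nat_const card_ord !mulnA.
rewrite big_distrr /=.
rewrite (eq_bigr (fun _ => n ^ l * \sum_a \sum_b weight i a b)) /=; last first.
  by move=> q ne; rewrite -(sum_two_positions (weight i) ne) mulnA mulnn.
rewrite sum_nat_const; congr (_ * _).
by rewrite cardC1 card_ord.
Qed.

(** Cauchy-Schwarz over the shared vertex [u] bounds the left side by pairs of triples through [u].
    Those of equal colour number at most 2 for each first triple; the others are Kikuchi pairs. *)
Lemma triples_square : triples ^ 2 <= #|V| * (total_weight + 2 * triples).
Proof.
apply: leq_trans (sum_square _) _; rewrite leq_mul //.
have -> : total_weight = \sum_u \sum_a \sum_b \sum_a' \sum_b' kikuchi_pair u a a' b b'.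
  rewrite /total_weight exchange_big; under eq_bigr do rewrite exchange_big.
  rewrite [RHS]exchange_big; apply: eq_bigr => a _.
  rewrite [RHS]exchange_big; apply: eq_bigr => b _.
  rewrite /weight exchange_big; apply: eq_bigr => u _.
  rewrite exchange_big; apply: eq_bigr => a' _.
  rewrite exchange_big; apply: eq_bigr => b' _.
  exact: sum_colours.
rewrite /triples big_distrr -big_split /=; apply: leq_sum => u _.
apply: (@leq_trans (\sum_a \sum_b \sum_a' \sum_b'
   (kikuchi_pair u a a' b b' +
    t u a a' * (t u b b' && (col u b b' == col u a a'))))).
  rewrite -mulnn big_distrl; apply: leq_sum => a _.
  rewrite big_distrr; apply: leq_sum => b _ /=.
  rewrite big_distrl; apply: leq_sum => a' _ /=.
  rewrite big_distrr; apply: leq_sum => b' _ /=.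
  rewrite /kikuchi_pair eq_sym.
  by case: (t u a a') (t u b b') (_ == _) => [] [] [].
under eq_bigr => a _.
  under eq_bigr => b _.
    under eq_bigr => a' _ do rewrite big_split /=.
    rewrite big_split /=; over.
  rewrite big_split /=; over.
rewrite big_split /= leq_add2l big_distrr; apply: leq_sum => a _ /=.
rewrite exchange_big big_distrr; apply: leq_sum => a' _ /=.
under eq_bigr do rewrite -big_distrr /=.
by rewrite -big_distrr /= mulnC leq_mul.
Qed.

Definition vec (x : tuple_) : U := (\sum_p delta (x p))%R.

Lemma vec_update x r v : vec (update x r v) = (vec x + delta (x r) + delta v)%R.
Proof.
rewrite /vec (bigD1 r) //= update_eq [in RHS](bigD1 r) //=.
rewrite [(_ + delta (x r))%R]addrC (addrA (delta (x r))) addUU add0r addrC.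
congr (_ + _)%R.
by apply: eq_bigr => s ne; rewrite update_neq.
Qed.

(** In characteristic 2 the vector of the apex may be added twice, which completes the four
    exchanged entries to two hyperedges. *)
Lemma vec_diff z : valid z -> (vec (source z) - vec (target z) =
  (delta (apex z) + delta (old1 z) + delta (new1 z)) +
  (delta (apex z) + delta (old2 z) + delta (new2 z)))%R.
Proof.
case/andP=> ne _; rewrite opprU /target !vec_update update_neq // -/(old1 z) -/(old2 z).
rewrite -2!(addrA (delta (apex z)) (delta (_ z)) (delta (_ z))) addrACA addUU add0r.
by rewrite -!addrA (addrA (vec _) (vec _)) addUU add0r.
Qed.

(** * Discarding heavy labels *)

Variable Delta : nat.

Definition heavy_label z := Delta < out_weight (colour1 z) (source z).
(** The four conditions control both colours at both ends, for the out-degree and the in-degree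
    bounds. *)
Definition kept := [set z | valid z &&
  ~~ [|| heavy_label z, heavy_label (swap z), heavy_label (reverse z) |
         heavy_label (swap (reverse z))]].

Let tame i x := [set z | [&& valid z, source z == x, colour1 z == i & ~~ heavy_label z]].

Let card_tame i x : #|tame i x| <= Delta.
Proof.
have [->|/set0Pn[z]] := eqVneq (tame i x) set0; first by rewrite cards0.
rewrite inE /heavy_label -leqNgt => /and4P[_ /eqP-> /eqP-> le].
apply: leq_trans le; rewrite -card_out_labels; apply: subset_leq_card.
by apply/subsetP=> z'; rewrite !inE => /and4P[-> -> -> _].
Qed.

Let card_swap (Q : pred label) : #|[set z | Q (swap z)]| = #|[set z | Q z]|.
Proof.
rewrite -(card_imset _ (inv_inj swapK)); apply: eq_card => z; apply/imsetP/idP.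
  by case=> z'; rewrite !inE => Qz ->.
by rewrite inE => Qz; exists (swap z); rewrite ?inE swapK.
Qed.

Let card_reverse (Q : pred label) :
  #|[set z | valid z && Q (reverse z)]| <= #|[set z | valid z && Q z]|.
Proof.
have inj : {in [set z | valid z && Q (reverse z)] &, injective reverse}.
  apply: (can_in_inj (g := reverse)) => z; rewrite inE => /andP[/andP[ne _] _].
  exact: reverseK.
rewrite -(card_in_imset inj); apply: subset_leq_card; apply/subsetP=> y.
case/imsetP=> z; rewrite !inE => /andP[vz Qz] ->.
by rewrite valid_reverse.
Qed.

Let separated_colour i z : valid z -> ~~ W i (vec (source z) - vec (target z))%R ->
  (colour1 z == i) || (colour2 z == i).
Proof.
move=> vz; apply: contraR; rewrite negb_or => /andP[n1 n2]; rewrite vec_diff //.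
have /andP[_ /and3P[t1 t2 _]] := vz.
by apply: WD; apply: other_colour.
Qed.

(** If the difference lay in [W] of the first colour, subtracting the second hyperedge, which has
    another colour, would put the first one there. *)
Let kept_separated z : z \in kept ->
  exists i, ~~ W i (vec (source z) - vec (target z))%R.
Proof.
rewrite inE => /andP[vz _]; exists (colour1 z); rewrite vec_diff //.
have /andP[_ /and3P[t1 t2 ne]] := vz.
apply: contra (own_colour t1) => h.
have /(WB h) : W (colour1 z) (delta (apex z) + delta (old2 z) + delta (new2 z))%R.
  by apply: other_colour => //; rewrite eq_sym.
by rewrite addrK.
Qed.

Let card_tame2 i x :
  #|tame i x :|: [set z | swap z \in tame i x]| <= 2 * Delta.
Proof.
rewrite (leq_trans (leq_card_setU _ _).1) // (card_swap (mem (tame i x))).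
have -> : [set z | mem (tame i x) z] = tame i x by apply/setP => z; rewrite inE.
by rewrite mul2n -addnn leq_add.
Qed.

Let kept_out_degree i x :
  #|[set z in kept | (source z == x) &&
      ~~ W i (vec (source z) - vec (target z))%R]| <= 2 * Delta.
Proof.
apply: leq_trans (card_tame2 i x); apply/subset_leq_card/subsetP => z.
rewrite !inE !negb_or valid_swap => /and3P[/andP[vz /and4P[h1 h2 _ _]] sx sep].
rewrite vz h1 h2 !andbT; have -> : source (swap z) == x by [].
by rewrite ?sx /= separated_colour.
Qed.

Let kept_in_degree i x :
  #|[set z in kept | (target z == x) &&
      ~~ W i (vec (source z) - vec (target z))%R]| <= 2 * Delta.
Proof.
pose Q z := (z \in tame i x) || (swap z \in tame i x).
apply: (@leq_trans #|[set z | valid z && Q (reverse z)]|).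
  apply/subset_leq_card/subsetP => z.
  rewrite /Q !inE !negb_or valid_swap => /and3P[/andP[vz /and4P[_ _ h1 h2]] tx sep].
  rewrite vz valid_reverse //= h1 h2 !andbT.
  have -> : source (swap (reverse z)) == x by [].
  rewrite ?[source (reverse z) == x]tx /=.
  have /andP[ne _] := vz; rewrite colour1_reverse // [colour1 (swap _)]colour2_reverse.
  exact: separated_colour.
apply: leq_trans (card_reverse Q) _; apply: leq_trans (card_tame2 i x).
apply/subset_leq_card/subsetP => z.
by rewrite in_set in_setU [X in _ || X]in_set => /andP[_].
Qed.

Lemma card_kept M : n ^ l <= 2 ^ M -> #|kept| <= 4 * Delta * n ^ l * M.
Proof.
move=> leM.
have cT : #|[set: tuple_]| = n ^ l by rewrite cardsT card_ffun card_ord.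
have := @separated_edges_bound _ _ _ (fun i x y => W i (vec x - vec y)%R)
  source target
  kept (2 * Delta) (congruence_equiv vec) kept_separated kept_out_degree
  kept_in_degree [set: tuple_] M.
rewrite cT mulnA; apply=> // z _; by rewrite !inE.
Qed.

Lemma card_valid_le :
  #|[set z | valid z]| <= #|kept| + 4 * #|[set z | valid z && heavy_label z]|.
Proof.
pose h2 := [set z | valid z && heavy_label (swap z)].
pose h3 := [set z | valid z && heavy_label (reverse z)].
pose h4 := [set z | valid z && heavy_label (swap (reverse z))].
pose h1 := [set z | valid z && heavy_label z].
have c2 : #|h2| = #|h1|.
  rewrite -(card_swap (fun z => valid z && heavy_label z)).
  by apply: eq_card => z; rewrite !inE valid_swap.
have c3 : #|h3| <= #|h1| by apply: (card_reverse heavy_label).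
have c4 : #|h4| <= #|h2| by apply: (card_reverse (fun z => heavy_label (swap z))).
apply: (@leq_trans #|kept :|: (h1 :|: (h2 :|: (h3 :|: h4)))|).
  apply/subset_leq_card/subsetP => z; rewrite !inE => ->.
  by do 4!case: heavy_label.
have cU (A B : {set label}) a b : #|A| <= a -> #|B| <= b -> #|A :|: B| <= a + b.
  by move=> lea leb; apply: leq_trans (leq_card_setU A B).1 (leq_add lea leb).
have -> x : 4 * x = x + (x + (x + x)) by lia.
do 2!apply: (@cU) => //; apply: (@cU); first by rewrite c2.
by apply: (@cU) => //; apply: leq_trans c4 _; rewrite c2.
Qed.

(** Markov's inequality: summing [out_weight] at the source and first colour over all valid labels
    gives the second moment. *)
Lemma card_heavy_label :
  n * (Delta * #|[set z | valid z && heavy_label z]|) <=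
  (4 * #|C| * l ^ 2 + 8 * D * n) * #|[set z | valid z]|.
Proof.
rewrite card_valid big_distrr /=.
apply: (@leq_trans (\sum_i n * \sum_x out_weight i x * out_weight i x)); last first.
  by apply: leq_sum => i _; apply: second_moment.
rewrite -big_distrr leq_mul //=.
rewrite card_set_sum big_distrr /=.
apply: (@leq_trans (\sum_z \sum_i \sum_x
   [&& valid z, source z == x & colour1 z == i] * out_weight i x)).
  apply: leq_sum => z _.
  rewrite (bigD1 (colour1 z)) //= (bigD1 (source z)) //= !eqxx !andbT.
  case: (valid z); rewrite ?muln0 //= /heavy_label mul1n.
  case: ltnP => [/ltnW|_]; rewrite ?muln0 // muln1 => le.
  by rewrite -addnA (leq_trans le) ?leq_addr.
rewrite exchange_big; apply: leq_sum => i _.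
rewrite exchange_big; apply: leq_sum => x _.
by rewrite -big_distrl /= -card_set_sum card_out_labels.
Qed.

(** By the last hypothesis at most an eighth of the valid labels are heavy, so at least half are
    kept. Then [card_kept] bounds the number of valid labels, which [card_valid_weight] expresses
    through the total weight. *)
Theorem kikuchi_bound L : 0 < n -> 0 < l -> n <= 2 ^ L ->
  8 * (4 * #|C| * l ^ 2 + 8 * D * n) <= n * Delta ->
  l.-1 * total_weight <= 8 * Delta * n ^ 2 * L.
Proof.
move=> n0 l0 nL hD.
have kM : #|kept| <= 4 * Delta * n ^ l * (l * L).
  by apply: card_kept; rewrite mulnC expnM; case: l l0 => // l' _; rewrite leq_exp2r.
have h1 := card_valid_le; have h2 := card_heavy_label; have h3 := card_valid_weight.
set v := #|[set z | valid z]| in h1 h2 h3.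
set h := #|[set z | valid z && heavy_label z]| in h1 h2.
set M' := 4 * #|C| * l ^ 2 + 8 * D * n in hD h2.
have v2 : v <= 2 * #|kept|.
  case: (posnP v) => [->//|v0].
  (* The factor [M'] has to be cancelled; it is positive because a valid label supplies a colour. *)
  case: (posnP M') => [E|M0]; last by nia.
  have : 0 < #|C| * l ^ 2.
    rewrite muln_gt0 expn_gt0 l0 /= andbT.
    have /card_gt0P[z _] := v0.
    by apply/card_gt0P; exists (colour1 z).
  by rewrite /M' in E; lia.
have p0 : 0 < l * n ^ l by rewrite muln_gt0 l0 expn_gt0 n0.
rewrite -(leq_pmul2l p0).
have -> : l * n ^ l * (l.-1 * total_weight) = n ^ 2 * v by rewrite h3; lia.
apply: (leq_trans (leq_mul (leqnn (n ^ 2)) v2)).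
apply: (leq_trans (leq_mul (leqnn (n ^ 2)) (leq_mul (leqnn 2) kM))).
by apply/eq_leq; lia.
Qed.

End Kikuchi.
End TripleSystem.

(** * Heavy and light pairs *)

(** Eliminating [G] and [Delta] leaves k^3 <= 6.7 * 10^10 * X^3 n, against (10^4 X)^3 n <= k^3. *)
Lemma kikuchi_arith (n k q L l Delta G : nat) (X := q ^ 2 * L) :
  0 < n -> 0 < q -> 0 < L -> 1 < l ->
  100 * 100 * X * l <= k -> k <= 2 * (100 * 100 * X * l) ->
  (100 * 100 * X) ^ 3 * n <= k ^ 3 ->
  n * Delta <= 32 * k * l ^ 2 + 65 * (200 * q * L) * n ->
  k ^ 2 * n <= 8 * q ^ 2 * G ->
  l.-1 * G <= 8 * Delta * n ^ 2 * L -> False.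
Proof.
move=> n0 q0 L0 l1 lk kl hk hD hG hl.
have X0 : 0 < X by rewrite muln_gt0 expn_gt0 q0.
have A : l.-1 * k ^ 2 <= 64 * X * (n * Delta).
  rewrite -(leq_pmul2r n0).
  apply: (@leq_trans (8 * q ^ 2 * (l.-1 * G))).
    by have := leq_mul (leqnn l.-1) hG; lia.
  by apply: (leq_trans (leq_mul (leqnn _) hl)); rewrite /X; lia.
have B : l * k ^ 2 <= 128 * X * (32 * k * l ^ 2 + 65 * (200 * q * L) * n).
  apply: (@leq_trans (2 * (l.-1 * k ^ 2))); first by rewrite mulnA leq_mul //; lia.
  apply: (leq_trans (leq_mul (leqnn 2) A)).
  apply: (leq_trans (leq_mul (leqnn 2) (leq_mul (leqnn _) hD))).
  by apply/eq_leq; lia.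
(* The term in k l^2 costs at most half of the left side of [B], since 64 * 128 <= 10^4. *)
have E : 2 * (128 * X * (32 * k * l ^ 2)) <= l * k ^ 2.
  have -> : 2 * (128 * X * (32 * k * l ^ 2)) = (64 * 128 * X * l) * (k * l) by lia.
  have -> : l * k ^ 2 = k * (k * l) by lia.
  by rewrite leq_mul2r; apply/orP; right; lia.
have F : l * k ^ 2 <= 2 * 128 * 65 * 200 * (X * q * L * n) by lia.
have H : k ^ 3 <= 2 * (100 * 100 * X) * (2 * 128 * 65 * 200 * (X * q * L * n)).
  apply: (leq_trans _ (leq_mul (leqnn _) F)).
  rewrite [k ^ 3]expnS mulnA leq_mul2r; apply/orP; right; lia.
have Y : X * (X * q * L * n) <= X ^ 3 * n.
  have XqL : q * L <= X by rewrite /X -mulnn -mulnA leq_pmull.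
  have -> : X * (X * q * L * n) = X * X * n * (q * L) by lia.
  have -> : X ^ 3 * n = X * X * n * X by lia.
  by rewrite leq_mul.
have Z : 0 < X ^ 3 * n by rewrite muln_gt0 expn_gt0 X0.
have := leq_trans hk H; rewrite expnMn -(mulnA _ (X ^ 3)).
have -> : 2 * (100 * 100 * X) * (2 * 128 * 65 * 200 * (X * q * L * n)) =
  (2 * 100 * 100 * 2 * 128 * 65 * 200) * (X * (X * q * L * n)) by lia.
move: (X ^ 3 * n) (X * (X * q * L * n)) Y Z => y z Y Z; lia.
Qed.

Section LightTriples.
Variables (V C : finType) (U : zmodType) (delta : V -> U) (W : C -> pred U).
Variables (t : V -> V -> V -> bool) (col : V -> V -> V -> C).
Hypothesis sys : triple_system delta W t col.
Variable D : nat.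

Definition light u a b :=
  [&& t u a b, codeg t u a <= D, codeg t u b <= D & codeg t a b <= D].

Lemma codegC a b : codeg t a b = codeg t b a.
Proof. by apply: eq_bigr => u _; rewrite (triple_swap12 sys). Qed.

Lemma light_system : triple_system delta W light col.
Proof.
split; try by case: sys.
- move=> u a b; rewrite /light (triple_swap12 sys) (codegC u a).
  by case: (t a u b); case: (codeg t a u <= D); case: (codeg t u b <= D);
    case: (codeg t a b <= D).
- move=> u a b; rewrite /light (triple_swap23 sys) (codegC a b).
  by case: (t u b a); case: (codeg t u a <= D); case: (codeg t u b <= D);
    case: (codeg t b a <= D).
- move=> u i; apply: leq_trans (triple_colour_degree sys u i).
  by do 2!(apply: leq_sum => ? _); rewrite /light; case: (t _ _ _); case: (_ == i);
    rewrite ?andbF ?leq_b1.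
- by move=> i u a b /and4P[tu _ _ _]; apply: (triple_other_colour sys).
- by move=> u a b /and4P[tu _ _ _]; apply: (triple_own_colour sys).
Qed.

Lemma light_codegree u b : \sum_b' light u b b' <= D.
Proof.
rewrite /light; case: (leqP (codeg t u b) D) => le /=; last first.
  by rewrite big1 // => b' _; rewrite andbF.
by apply: leq_trans le; apply: leq_sum => b' _; case: (t u b b') => //=; case: (_ && _).
Qed.

(** A triple that is not light has one of its three pairs heavy, and by symmetry each position of
    the pair gives the same count. *)
Lemma triples_light_heavy :
  triples t <= triples light + 3 * \sum_u \sum_a \sum_b (t u a b && (D < codeg t a b)).
Proof.
pose h u a b := t u a b && (D < codeg t a b).
have E1 : \sum_u \sum_a \sum_b h b u a = \sum_u \sum_a \sum_b h u a b.
  by rewrite [RHS]exchange_big; apply: eq_bigr => u _; rewrite exchange_big.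
have E2 : \sum_u \sum_a \sum_b h a u b = \sum_u \sum_a \sum_b h u a b.
  by rewrite exchange_big.
rewrite -[\sum_u _]/(\sum_u \sum_a \sum_b h u a b).
have -> x : 3 * x = x + (x + x) by lia.
rewrite -{2}E1 -{2}E2 /triples -!big_split /=; apply: leq_sum => u _.
rewrite -!big_split /=; apply: leq_sum => a _.
rewrite -!big_split /=; apply: leq_sum => b _.
have tb : t b u a = t u a b by rewrite (codeg_rotate sys a) (codeg_rotate sys u).
rewrite /h /light (triple_swap12 sys a) tb.
case: (t u a b) => //=.
by case: (leqP (codeg t u a)); case: (leqP (codeg t u b)); case: (leqP (codeg t a b)).
Qed.
End LightTriples.

Lemma ceil_multiple m n : 0 < n -> exists2 d, m <= n * d & n * d <= m + n.
Proof.
move=> n0; exists (m %/ n).+1; first by rewrite mulnC ltnW // ltn_ceil.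
by rewrite mulnS addnC leq_add2r mulnC leq_divM.
Qed.

Theorem triple_system_bound (V C : finType) (U : zmodType) (delta : V -> U)
    (W : C -> pred U) (t : V -> V -> V -> bool) (col : V -> V -> V -> C) (q L : nat) :
  triple_system delta W t col -> 0 < #|V| -> 0 < q -> 0 < L -> #|V| <= 2 ^ L ->
  #|C| * #|V| <= q * triples t ->
  #|C| ^ 3 < (100 * 100 * 100 * (q ^ 2 * L)) ^ 3 * #|V|.
Proof.
move=> sys n0 q0 L0 nL hs; rewrite ltnNge; apply/negP => hk.
set n := #|V| in n0 nL hs hk; set k := #|C| in hs hk; set X := q ^ 2 * L in hk.
have X0 : 0 < X by rewrite muln_gt0 expn_gt0 q0.
have XqL : q * L <= X by rewrite /X -mulnn -mulnA leq_pmull.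
have kX : 100 * 100 * 100 * X <= k.
  by rewrite -(@leq_exp2r _ _ 3) // (leq_trans _ hk) // leq_pmulr.
pose D := 200 * q * L; pose P := #|heavy_pairs t D|.
set s := triples t in hs.
(* Here n + n^2 <= 2 * 2^(2L) <= 2^(3L). *)
have heavy : \sum_u \sum_a \sum_b (t u a b && (D < codeg t a b)) <= 4 * (n + P) * (3 * L).
  apply: (heavy_triples_bound sys); rewrite -/n.
  apply: (@leq_trans (2 ^ L * 2 ^ L + 2 ^ L * 2 ^ L)).
    by rewrite -mulnn leq_add ?leq_mul // (leq_trans nL) // leq_pmulr ?expn_gt0.
  rewrite addnn -mul2n -expnD -expnS leq_exp2l //; lia.
have split_s := triples_light_heavy sys D; rewrite -/s in split_s.
have PD : D * P <= s := card_heavy_pairs sys D.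
have lightsys := light_system sys D.
set sl := triples (light t D) in split_s.
(* The heavy triples cost 36 L (n + P), and both 36 L n and 36 L P are at most s / 4. *)
have sl2 : s <= 2 * sl.
  have b1 : 144 * L * P <= s.
    apply: leq_trans PD; rewrite leq_mul2r /D; apply/orP; right.
    have : L <= q * L by rewrite leq_pmull.
    lia.
  have b2 : 144 * L * n <= s.
    rewrite -(leq_pmul2l q0); apply: leq_trans hs.
    rewrite mulnA leq_mul2r; apply/orP; right; lia.
  lia.
(* This makes the term 2 n sl of [triples_square] at most half of sl^2. *)
have sl4 : 4 * n <= sl.
  rewrite -(@leq_pmul2l (2 * q)) ?muln_gt0 ?q0 //.
  apply: (@leq_trans (k * n)).
    rewrite mulnA leq_mul2r; apply/orP; right.
    have : q * 1 <= q * L by rewrite leq_mul2l L0 orbT.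
    lia.
  by apply: (leq_trans hs); have := leq_mul (leqnn q) sl2; lia.
have sq := triples_square lightsys; rewrite -/sl -/n in sq.
set G := total_weight _ _ in sq.
have sG : sl ^ 2 <= 2 * n * G.
  have : 4 * n * sl <= sl ^ 2 by rewrite -mulnn leq_mul.
  lia.
have kG : k ^ 2 * n <= 8 * q ^ 2 * G.
  rewrite -(leq_pmul2r n0).
  have h1 : k * n <= 2 * (q * sl).
    by apply: (leq_trans hs); rewrite mulnCA leq_mul2l sl2 orbT.
  move: (leq_mul h1 h1) (leq_mul (leqnn (4 * q ^ 2)) sG); clear; lia.
(* This length is at least 100, and small enough for [kikuchi_arith] to absorb the k l^2 term of the
   second moment. *)
pose l := k %/ (100 * 100 * X).
have d0 : 0 < 100 * 100 * X by rewrite muln_gt0 X0.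
have l1 : 1 < l by rewrite leq_divRL //; move: kX; clear; lia.
have lk : 100 * 100 * X * l <= k by rewrite mulnC leq_divM.
have kl : k <= 2 * (100 * 100 * X * l).
  have : k < l.+1 * (100 * 100 * X) by rewrite ltn_ceil.
  have : 100 * 100 * X <= 100 * 100 * X * l by rewrite leq_pmulr // ltnW.
  clear; lia.
have D0 : 0 < D by rewrite /D !muln_gt0 q0.
(* The factor 8 leaves at most an eighth of the labels heavy on each of the
   four sides, so that half of them are kept. *)
have [Delta nDge nDle'] := ceil_multiple (8 * (4 * k * l ^ 2 + 8 * D * n)) n0.
(* Rounding up to a multiple of n adds at most n <= D n, whence 65 rather than 64. *)
have nDle : n * Delta <= 32 * k * l ^ 2 + 65 * D * n.
  apply: leq_trans nDle' _.
  apply: (leq_trans (leq_add (leqnn _) (leq_pmull n D0))).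
  have E d e : 8 * (4 * k * e + 8 * d * n) + d * n = 32 * k * e + 65 * d * n by lia.
  by rewrite E.
have := kikuchi_bound lightsys (light_codegree t D) n0 (ltnW l1) nL nDge.
apply: (kikuchi_arith n0 q0 L0 l1 lk kl _ nDle kG).
apply: leq_trans hk; rewrite leq_mul2r leq_exp2r //; apply/orP; right; lia.
Qed.

(** * From hypergraphs to triple systems *)

Section HypergraphTriples.
Variables (V : finType) (k : nat) (E : {set {set V}}) (c : {set V} -> 'I_k).
Hypothesis uniE : uniform 3 E.
Hypothesis properE : proper_colouring E c.
Hypothesis no_unique_colour : forall S : {set {set V}},
  S \subset E -> even_cover S -> forall i, #|colour_class S c i| <> 1.

Let t u a b := [set u; a; b] \in E.
Let col u a b := c [set u; a; b].
Let U := {ffun V -> 'F_2}.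
Let delta v : U := [ffun w => (w == v)%:R%R].

Let combination (f : {set V} -> 'F_2) : U := ([ffun v => \sum_e f e * (v \in e)%:R])%R.
Let avoiding i (f : {set V} -> 'F_2) :=
  [forall e, (f e != 0%R) ==> (e \in E) && (c e != i)].
(** Membership carries an explicit coefficient function because its support becomes the even cover
    in [own_colour]. *)
Let W i : pred U := [pred w | [exists f : {ffun {set V} -> 'F_2},
  avoiding i f && (w == combination f)]].

Let set3_swap12 (u a b : V) : [set u; a; b] = [set a; u; b].
Proof. by rewrite (setUC [set u]). Qed.

Let set3_swap23 (u a b : V) : [set u; a; b] = [set u; b; a].
Proof. by rewrite -!setUA (setUC [set a]). Qed.

Let triple_distinct u a b : t u a b -> [/\ u != a, u != b & a != b].
Proof.
move/uniE; rewrite setUC cardsU1 cards2 !inE negb_or eq_sym [b == a]eq_sym.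
by case: (u != b); case: (a != b); case: (u != a).
Qed.

Let delta3 u a b : t u a b ->
  (delta u + delta a + delta b)%R = [ffun v => (v \in [set u; a; b])%:R%R].
Proof.
case/triple_distinct => ua ub ab; apply/ffunP=> v; rewrite !ffunE !inE.
case: (eqVneq v u) => [->|_]; first by rewrite (negbTE ua) (negbTE ub) !addr0.
case: (eqVneq v a) => [->|_]; first by rewrite (negbTE ab) addr0 add0r.
by rewrite !add0r.
Qed.

(** Edges of one colour are disjoint, so at most one of them contains [u], and it is counted in two
    orders. *)
Let colour_degree u i : \sum_a \sum_b (t u a b && (col u a b == i)) <= 2.
Proof.
rewrite -(sum_pair (fun z => nat_of_bool (t u z.1 z.2 && (col u z.1 z.2 == i)))).
rewrite -card_set_sum.
set T := [set z | _]; have [->|/set0Pn[[a b]]] := eqVneq T set0; first by rewrite cards0.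
rewrite inE /= => /andP[tab /eqP ci].
apply: (@leq_trans #|[set (a, b); (b, a)]|); last by rewrite cards2; case: (_ != _).
apply/subset_leq_card/subsetP => -[a' b']; rewrite !inE /= => /andP[tab' /eqP ci'].
have eqe : [set u; a'; b'] = [set u; a; b].
  apply/eqP; apply: contraT => ne.
  have := properE tab' tab ne; rewrite -/(col u a b) ci -ci'.
  move=> /(_ erefl)/disjoint_setI0/setP/(_ u).
  by rewrite !inE eqxx.
have [ua ub ab] := triple_distinct tab; have [ua' ub' ab'] := triple_distinct tab'.
have /setP/(_ a') := eqe; have /setP/(_ b') := eqe; rewrite !inE !eqxx !orbT /=.
rewrite [a' == u]eq_sym (negbTE ua') [b' == u]eq_sym (negbTE ub') /=.
move=> /esym/orP[]/eqP eb /esym/orP[]/eqP ea; rewrite ea eb ?eqxx ?orbT // in ab' *.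
Qed.

Let F2_add x : (x + x = 0 :> 'F_2)%R.
Proof. by case: x => [[|[|]]] // i; apply/eqP. Qed.

Let W0 i : W i 0%R.
Proof.
apply/existsP; exists 0%R; apply/andP; split.
  by apply/forallP=> e; rewrite ffunE eqxx.
apply/eqP/ffunP=> v; rewrite !ffunE big1 // => e _.
by rewrite ffunE mul0r.
Qed.

Let WB i x y : W i x -> W i y -> W i (x - y)%R.
Proof.
case/existsP=> f /andP[/forallP fE /eqP->] /existsP[g /andP[/forallP gE /eqP->]].
apply/existsP; exists (f - g)%R; apply/andP; split.
  apply/forallP=> e; apply/implyP; rewrite !ffunE => ne.
  have := fE e; have := gE e; move: ne; case: (eqVneq (f e) 0%R) => [->|_] //=.
  by case: (eqVneq (g e) 0%R) => [->|_] //=; rewrite subr0 eqxx.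
apply/eqP/ffunP=> v; rewrite !ffunE -sumrB; apply: eq_bigr => e _.
by rewrite !ffunE mulrBl.
Qed.

Let other_colour i u a b : t u a b -> col u a b != i ->
  W i (delta u + delta a + delta b)%R.
Proof.
move=> tu ci; rewrite delta3 //; apply/existsP.
exists [ffun e => (e == [set u; a; b])%:R%R]; apply/andP; split.
  apply/forallP=> e; apply/implyP; rewrite ffunE.
  by case: (eqVneq e [set u; a; b]) => [->|]; rewrite ?eqxx // => _; apply/andP.
apply/eqP/ffunP=> v; rewrite !ffunE (bigD1 [set u; a; b]) //= ffunE eqxx mul1r.
rewrite big1 ?addr0 // => e ne; by rewrite ffunE (negbTE ne) mul0r.
Qed.

(** If the other colours spanned this edge, it would form, with the support of the combination, an
    even cover in which its colour appears once. *)
Let own_colour u a b : t u a b -> ~~ W (col u a b) (delta u + delta a + delta b)%R.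
Proof.
move=> tu; rewrite delta3 //; apply/negP; rewrite /col.
set e0 := [set u; a; b]; case/existsP=> f /andP[/forallP fE /eqP/ffunP fv].
(* The combination avoids the colour of [e0], so [e0] is not already in its support. *)
have f0 : f e0 = 0%R.
  by apply/eqP; have := fE e0; rewrite eqxx andbF implybF negbK.
pose S := e0 |: [set e | f e != 0%R].
apply: (@no_unique_colour S _ _ (c e0)).
- apply/subsetP=> e; rewrite !inE => /orP[/eqP->//|fe].
  by have := fE e; rewrite fe => /andP[].
(* Evenness is read as vanishing in F_2, where every nonzero coefficient of [f] is 1. *)
- move=> v; rewrite -dvdn2 (dvdn_pcharf (pchar_Fp (isT : prime 2))).
  rewrite card_set_sum natr_sum (bigD1 e0) //= setU11 /=.
  have := fv v; rewrite !ffunE (bigD1 e0) //= f0 mul0r add0r => ->.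
  set Z := (X in (X + _)%R).
  rewrite (eq_bigr (fun e => f e * (v \in e)%:R)%R) ?F2_add //.
  move=> e ne; rewrite !inE (negbTE ne) /=.
  have [->|fe] := eqVneq (f e) 0%R; first by rewrite mul0r.
  suff -> : f e = 1%R by rewrite mul1r.
  by move: fe; case: (f e) => [[|[|]]] // i _; apply/eqP.
- rewrite (_ : colour_class S c (c e0) = [set e0]) ?cards1 //.
  apply/setP=> e; rewrite !inE; have [->|ne] := eqVneq e e0; first by rewrite eqxx.
  by have := fE e; case: (f e == 0%R) => //= /andP[_ /negbTE].
Qed.

Let card_triples : #|E| <= triples t.
Proof.
have -> : triples t = #|[set z : V * V * V | t z.1.1 z.1.2 z.2]|.
  by rewrite card_set_sum !sum_pair.
apply: leq_trans (leq_imset_card (fun z : V * V * V => [set z.1.1; z.1.2; z.2]) _).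
apply/subset_leq_card/subsetP => e eE; have ce := uniE eE.
have /card_gt0P[x xe] : 0 < #|e| by rewrite ce.
have /cards2P[y [z [_ eyz]]] : #|e :\ x| == 2.
  by have := cardsD1 x e; rewrite ce xe add1n => -[<-].
have ee : e = [set x; y; z] by rewrite -setUA -eyz setD1K.
by apply/imsetP; exists (x, y, z) => //; rewrite inE /t -ee.
Qed.

Theorem colours_bound (q L : nat) :
  0 < #|V| -> 0 < q -> 0 < L -> #|V| <= 2 ^ L -> k * #|V| <= q * #|E| ->
  k ^ 3 < (100 * 100 * 100 * (q ^ 2 * L)) ^ 3 * #|V|.
Proof.
move=> n0 q0 L0 nL hE; rewrite -{1}(card_ord k).
apply: (@triple_system_bound V 'I_k U delta W t col q L) => //.
- split=> //.
  + by move=> u a b; rewrite /t set3_swap12.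
  + by move=> u a b; rewrite /t set3_swap23.
  + by move=> u a b; rewrite /col set3_swap12.
  + by move=> u a b; rewrite /col set3_swap23.
  + by move=> x; apply/ffunP=> v; rewrite !ffunE F2_add.
- by rewrite card_ord (leq_trans hE) // leq_mul2l card_triples orbT.
Qed.
End HypergraphTriples.

(** * Real logarithms and the final constants *)

Local Open Scope ring_scope.

(** Rounding up adds at most 1, which is at most log n as n >= 2. *)
Lemma up_log_le_log2 (R : realType) (n : nat) : (1 < n)%N ->
  (up_log 2 n)%:R <= 2 * log2 n%:R :> R.
Proof.
move=> n1; have ln2 : 0 < ln 2 :> R by rewrite ln_gt0 // ltr1n.
have log1 : 1 <= log2 n%:R :> R.
  by rewrite /log2 ler_pdivlMr // mul1r ler_ln ?posrE ?ltr0n ?ler_nat //; lia.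
have /andP[lt _] := up_log_bounds (isT : (1 < 2)%N) n1.
have L0 : (0 < up_log 2 n)%N by rewrite up_log_gt0.
have : (up_log 2 n).-1%:R <= log2 n%:R :> R.
  rewrite /log2 ler_pdivlMr // mulr_natl -lnXn ?ltr0n //.
  by rewrite ler_ln ?posrE ?exprn_gt0 ?ltr0n // -?natrX ?ler_nat; lia.
have -> : up_log 2 n = (up_log 2 n).-1.+1 by rewrite prednK.
rewrite /= -natr1; lra.
Qed.

Lemma card_colour_classes (V : finType) (E : {set {set V}}) (k : nat)
    (c : {set V} -> 'I_k) : (\sum_i #|colour_class E c i|)%N = #|E|.
Proof.
rewrite -[RHS]sum1_card (partition_big c xpredT) //=; apply: eq_bigr => i _.
by rewrite -sum1_card; apply: eq_bigl => e; rewrite inE.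
Qed.

Theorem theorem2p8 (R : realType) :
  exists2 alpha0 : R, 0 < alpha0 &
  forall alpha : R, 0 < alpha -> alpha <= alpha0 ->
  let K : R := 10 ^+ 7 / alpha ^+ 2 in
  exists N : nat, forall n : nat, (N <= n)%N ->
  forall (V : finType) (E : {set {set V}}) (k : nat) (c : {set V} -> 'I_k),
    #|V| = n ->
    uniform 3 E ->
    proper_colouring E c ->
    K * n%:R `^ (3%:R^-1) * log2 n%:R <= k%:R ->
    (forall i : 'I_k, alpha * n%:R <= #|colour_class E c i|%:R) ->
  exists S : {set {set V}},
    [/\ S \subset E, even_cover S &
        exists i : 'I_k, #|colour_class S c i| = 1%N].
Proof.
exists 1 => // alpha a0 a1 K; exists 2%N => n n2 V E k c cV uniE properE hk hc.
apply: contrapT => noS.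
have n0 : 0 < n%:R :> R by rewrite ltr0n; lia.
(* An integer stand-in for 1 / alpha; as alpha <= 1, it is at most 2 / alpha. *)
pose q := (Num.truncn alpha^-1).+1; pose L := up_log 2 n.
have ai1 : 1 <= alpha^-1 by rewrite invf_ge1.
have q_ge : alpha^-1 <= q%:R by apply: ltW; exact: truncnS_gt.
have q_le : q%:R <= 2 * alpha^-1.
  have : (Num.truncn alpha^-1)%:R <= alpha^-1 by rewrite truncn_le // invr_ge0 ltW.
  by rewrite /q -natr1; lra.
have L_le := @up_log_le_log2 R n n2; rewrite -/L in L_le.
have L0 : (0 < L)%N by rewrite up_log_gt0.
have log0 : 0 <= log2 n%:R :> R by have : 0 <= L%:R :> R by []; lra.
have nL : (n <= 2 ^ L)%N by apply: up_logP.
(* Summing the class sizes gives k alpha n <= |E|, and q alpha >= 1. *)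
have kE : (k * n <= q * #|E|)%N.
  rewrite -(ler_nat R) !natrM -(card_colour_classes E c) natr_sum.
  have : \sum_(i < k) (alpha * n%:R) <= \sum_(i < k) #|colour_class E c i|%:R.
    by apply: ler_sum => i _; apply: hc.
  rewrite sumr_const card_ord -[_ *+ k]mulr_natl => hs.
  apply: le_trans (ler_wpM2l (ler0n _ q) hs).
  have -> : q%:R * (k%:R * (alpha * n%:R)) = k%:R * n%:R * (q%:R * alpha) :> R by ring.
  by rewrite ler_peMr ?mulr_ge0 // -ler_pdivrMr // mul1r.
have : (k ^ 3 < (100 * 100 * 100 * (q ^ 2 * L)) ^ 3 * #|V|)%N.
  apply: (@colours_bound V k E c) => //; rewrite ?cV //; last by lia.
  by move=> S SE evS i Si; apply: noS; exists S; split => //; exists i.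
rewrite cV ltnNge => /negP; apply.
rewrite -(ler_nat R) natrM !natrX.
have n13 : (n%:R `^ 3^-1) ^+ 3 = n%:R :> R.
  by rewrite -powR_mulrn ?powR_ge0 // -powRrM mulVf ?pnatr_eq0 // powRr1.
(* From q^2 <= 4 / alpha^2 and L <= 2 log n the constant becomes 8 * 10^6, below the 10^7 in [K]. *)
have hX : (100 * 100 * 100 * (q ^ 2 * L))%:R <= K * log2 n%:R.
  rewrite !natrM -(expr2 q%:R) /K.
  have aV : (alpha ^+ 2)^-1 = (alpha^-1) ^+ 2 by rewrite exprVn.
  have q2 : q%:R ^+ 2 <= 4 * (alpha^-1) ^+ 2 :> R.
    have -> : 4 * (alpha^-1) ^+ 2 = (2 * alpha^-1) ^+ 2 by rewrite exprMn -natrX.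
    by rewrite ler_sqr // ?nnegrE // mulr_ge0 // invr_ge0 ltW.
  have := ler_pM (exprn_ge0 2 (ler0n R q)) (ler0n R L) q2 L_le.
  rewrite aV; have : 0 <= alpha^-1 ^+ 2 * log2 n%:R.
    by rewrite mulr_ge0 // exprn_ge0 // invr_ge0 ltW.
  move: (q%:R ^+ 2 * L%:R) (alpha^-1 ^+ 2) (log2 n%:R) => x y z h1 h2; nra.
rewrite -[X in _ * X <= _]n13 -exprMn; apply: lerXn2r; rewrite ?nnegrE //.
  by rewrite mulr_ge0 // powR_ge0.
by apply: le_trans hk; rewrite mulrAC ler_wpM2r ?powR_ge0.
Qed.
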